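(* For all $x\in\mathbb{R}^d$, $$\log(f^0/f^1)(x) = -\frac12(\alpha_0(x)+\alpha_1(x))^T(\Omega-I_d)(\alpha_0(x)-\alpha_1(x))+\sum_{i=1}^d\log\frac{f_{i|0}(x_i)}{f_{i|1}(x_i)} = -\frac12(\alpha_0(x)+\alpha_1(x))^T\beta^*(x)+\sum_{i=1}^d\Delta\log f_i(x_i),$$ where $\beta^*(x)=(\Omega-I_d)\Delta\alpha(x)$.
   Context: $(X,Y)$ is a random vector in $\mathbb{R}^d\times\{0,1\}$, $X=(X_1,\dots,X_d)^T$, with $\mathbb{P}(Y=0)=\mathbb{P}(Y=1)=1/2$. The conditional laws $(X|Y=0)$ and $(X|Y=1)$ have continuous marginals and the same Gaussian copula, with (invertible) copula correlation matrix $\Sigma$, and are otherwise arbitrary; $\Omega=\Sigma^{-1}$, and $I_d$ is the $d\times d$ identity matrix. $f^y$ is the multivariate density of $(X|Y=y)$, i.e. the mixed derivative $\partial^d/\partial x_1\cdots\partial x_d$ of $\mathbb{P}(X\le x|Y=y)$, and $\log(f^0/f^1)(x)=\log(f^0(x)/f^1(x))$. For $i\in\{1,\dots,d\}$, $y\in\{0,1\}$, $F_{i|y}$ and $f_{i|y}$ are the distribution function and the density of $(X_i|Y=y)$. $\Phi$ is the $N(0,1)$ distribution function, $\alpha_{i|y}(t)=\Phi^{-1}(F_{i|y}(t))$, $\alpha_y(x)=(\alpha_{1|y}(x_1),\dots,\alpha_{d|y}(x_d))^T$; having Gaussian copula with correlation matrix $\Sigma$ means $(\alpha_y(X)|Y=y)\sim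 N(0,\Sigma)$. $\Delta\alpha(x)=\alpha_0(x)-\alpha_1(x)$ and $\Delta\log f_i(x_i)=\log f_{i|0}(x_i)-\log f_{i|1}(x_i)$. (Functions take values in the extended real line; the identity is understood at points where the expressions are well defined.) *)

(* Defs.v *)
From HB Require Import structures.
From mathcomp Require Import all_boot all_order all_algebra.
From mathcomp Require Import all_classical all_reals all_analysis.

Set Implicit Arguments.
Unset Strict Implicit.
Unset Printing Implicit Defensive.

Import Order.TTheory GRing.Theory Num.Theory.
Import numFieldNormedType.Exports.

Local Open Scope classical_set_scope.
Local Open Scope ring_scope.

Section normal_laws.
Context {R : realType}.

Definition Phi (t : R) : R := fine (normal_prob (0 : R) 1 `]-oo, t]).

(* The quantile function of N(0,1): the inverse of Phi on ]0, 1[, extended by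
   -oo at 0 and by +oo at 1. *)
Definition Phi_inv (p : R) : \bar R :=
  ereal_inf [set t%:E | t in [set t : R | p <= Phi t]].

Definition correlation_mx d (Sigma : 'M[R]_d) : Prop :=
  [/\ Sigma^T = Sigma,
      forall i, Sigma i i = 1
    & forall v : 'cV[R]_d, 0 <= (v^T *m Sigma *m v) ord0 ord0].

(* Iterated Lebesgue integral over R^d. For nonnegative measurable integrands,
   the only ones used below, it is the integral against d-dimensional Lebesgue
   measure (Tonelli). *)
Fixpoint lebesgue_integral_tuple (d : nat) :
    (d.-tuple R -> \bar R) -> \bar R :=
  match d with
  | 0 => fun f => f [tuple]
  | d'.+1 => fun f =>
      (\int[lebesgue_measure]_(t in [set: R])
        lebesgue_integral_tuple (fun z : d'.-tuple R => f [tuple of t :: z]))%E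
  end.

Definition mvnormal_pdf d (Sigma : 'M[R]_d) (z : d.-tuple R) : R :=
  let v := \col_(i < d) tnth z i in
  (Num.sqrt ((2 * pi) ^+ d * \det Sigma))^-1 *
  expR (- (v^T *m invmx Sigma *m v) ord0 ord0 / 2).

(* The law N(0, Sigma) on R^d, for an invertible covariance matrix Sigma. *)
Definition mvnormal_prob d (Sigma : 'M[R]_d) (B : set (d.-tuple R)) : \bar R :=
  lebesgue_integral_tuple (fun z => (mvnormal_pdf Sigma z * \1_B z)%:E).

End normal_laws.

Section mixed_derivative.
Context {R : realType} {d : nat}.
Implicit Types (f : 'cV[R]_d -> R) (x : 'cV[R]_d).

Definition unit_cv (i : 'I_d) : 'cV[R]_d := delta_mx i ord0.

(* The head of s is the outermost derivative. *)
Definition iter_partial (s : seq 'I_d) f : 'cV[R]_d -> R :=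
  foldr (fun i (g : 'cV[R]_d -> R) => fun x => 'D_(unit_cv i) g x) f s.

(* 'D is a total function; this is the existence of the iterated derivative at
   x, which requires that of the inner ones at all points near x on the line
   along which the outer one is taken. *)
Fixpoint iter_partial_ex (s : seq 'I_d) f x : Prop :=
  match s with
  | [::] => True
  | i :: s' =>
      (\forall h \near (0 : R), iter_partial_ex s' f (x + h *: unit_cv i)) /\
      derivable (iter_partial s' f) x (unit_cv i)
  end.

Definition mixed_partial f : 'cV[R]_d -> R := iter_partial (enum 'I_d) f.

Definition mixed_partial_ex f x : Prop := iter_partial_ex (enum 'I_d) f x.

End mixed_derivative.

(* Sums and products in \bar R follow the library, in particular 0 * +oo = 0.
   The value -oo that the library gives to (+oo) + (-oo), and its 0 for 0 / 0,
   are never used: these cases are excluded by [identity_defined] below. *)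
Section ereal_vectors.
Context {R : realType} {d : nat}.
Local Open Scope ereal_scope.

Definition esum_defined (u : 'I_d -> \bar R) : Prop :=
  forall i j, adde_def (u i) (u j).

Definition edot (u v : 'I_d -> \bar R) : \bar R := \sum_(i < d) u i * v i.

Definition emulmx (M : 'M[R]_d) (v : 'I_d -> \bar R) : 'I_d -> \bar R :=
  fun i => \sum_(j < d) (M i j)%:E * v j.

End ereal_vectors.

Section model.
Context {dT : measure_display} {T : measurableType dT} {R : realType}.
Context (P : probability T R) {d : nat}.
Context (X : {RV P >-> d.-tuple R}) (Y : {RV P >-> bool}).

(* The class labels 0 and 1 are the booleans false and true. *)
Definition class_event (y : bool) : set T := Y @^-1` [set y].

Definition cond_prob (y : bool) (A : set T) : R :=
  fine (P (A `&` class_event y)) / fine (P (class_event y)).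

Definition joint_cdf (y : bool) (x : 'cV[R]_d) : R :=
  cond_prob y [set w | forall i, tnth (X w) i <= x i ord0].

Definition joint_density (y : bool) : 'cV[R]_d -> R :=
  mixed_partial (joint_cdf y).

Definition marginal_cdf (y : bool) (i : 'I_d) (t : R) : R :=
  cond_prob y [set w | tnth (X w) i <= t].

Definition marginal_density (y : bool) (i : 'I_d) : R -> R :=
  (marginal_cdf y i)^`()%classic.

Definition alpha1 (y : bool) (i : 'I_d) (t : R) : \bar R :=
  Phi_inv (marginal_cdf y i t).

Definition alpha (y : bool) (x : 'cV[R]_d) : 'I_d -> \bar R :=
  fun i => alpha1 y i (x i ord0).

(* (alpha_y(X) | Y = y) ~ N(0, Sigma), the law of a vector of extended reals
   being tested on the Borel sets B of R^d; B = R^d shows that alpha_y(X) is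
   almost surely finite. *)
Definition gaussian_copula (y : bool) (Sigma : 'M[R]_d) : Prop :=
  forall B : set (d.-tuple R), measurable B ->
    (cond_prob y [set w | exists2 z, B z &
       forall i, alpha1 y i (tnth (X w) i) = (tnth z i)%:E])%:E =
    mvnormal_prob Sigma B.

Section pointwise.
Local Open Scope ereal_scope.

Definition sum_alpha (x : 'cV[R]_d) : 'I_d -> \bar R :=
  fun i => alpha false x i + alpha true x i.

Definition Delta_alpha (x : 'cV[R]_d) : 'I_d -> \bar R :=
  fun i => alpha false x i - alpha true x i.

Definition beta_star (Omega : 'M[R]_d) (x : 'cV[R]_d) : 'I_d -> \bar R :=
  emulmx (Omega - 1%:M)%R (Delta_alpha x).

Definition log_density_ratio (x : 'cV[R]_d) : \bar R :=
  lne ((joint_density false x)%:E / (joint_density true x)%:E).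

Definition log_marginal_ratio (i : 'I_d) (t : R) : \bar R :=
  lne ((marginal_density false i t)%:E / (marginal_density true i t)%:E).

Definition Delta_log_f (i : 'I_d) (t : R) : \bar R :=
  lne (marginal_density false i t)%:E - lne (marginal_density true i t)%:E.

(* All derivatives that define densities at x exist, and none of the expressions
   in the identity takes the form 0 / 0 or (+oo) + (-oo). *)
Definition identity_defined (Omega : 'M[R]_d) (x : 'cV[R]_d) : Prop :=
  [/\ [/\ forall y, mixed_partial_ex (joint_cdf y) x,
          forall y i, derivable (marginal_cdf y i) (x i ord0) (1%R : R),
          ~ (joint_density false x = 0%R /\ joint_density true x = 0%R)
        & forall i, ~ (marginal_density false i (x i ord0) = 0%R /\
                       marginal_density true i (x i ord0) = 0%R)],
      [/\ forall i, adde_def (alpha false x i) (alpha true x i),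
          forall i, adde_def (alpha false x i) (- alpha true x i),
          forall i, esum_defined
            (fun j => ((Omega - 1%:M)%R i j)%:E * Delta_alpha x j)
        & esum_defined (fun i => sum_alpha x i * beta_star Omega x i)]
    & [/\ esum_defined (fun i => log_marginal_ratio i (x i ord0))
        & adde_def ((- 2^-1)%:E * edot (sum_alpha x) (beta_star Omega x))
            (\sum_(i < d) log_marginal_ratio i (x i ord0))]].

End pointwise.

End model.

(* Main.v *)
Require Import Defs.
From HB Require Import structures.
From mathcomp Require Import all_boot all_order all_algebra.
From mathcomp Require Import all_classical all_reals all_analysis.
From mathcomp Require Import measurable_realfun.
From mathcomp Require Import ring.

Set Implicit Arguments.
Unset Strict Implicit.
Unset Printing Implicit Defensive.

Import Order.TTheory GRing.Theory Num.Theory.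
Import numFieldNormedType.Exports.

Local Open Scope classical_set_scope.
Local Open Scope ring_scope.

(** Why the identity holds.  Where all normal scores [a_i] of class [y] are
    finite, Sklar's theorem and the Gaussian copula give the joint density
      f^y(x) = phi_Sigma(a) * prod_i (f_{i|y}(x_i) / phi(a_i)),
    phi_Sigma and phi being the N(0, Sigma) and N(0, 1) densities
    ([gaussian_copula_density]).  In the logarithm of the ratio of two such
    products the normalizing constants cancel.  What remains of the Gaussian
    factors is half the difference of the values of the quadratic form of
    [Omega - 1] at the two score vectors; as [Omega] is symmetric, this
    difference of squares factors into the bilinear expression of the theorem
    ([quadratic_form_difference], [gaussian_copula_log_ratio]).

    The density formula is proved without differentiating an integral.  The
    mixed partial derivative is by definition an iterated limit of quotients
    (increment of the distribution function over a box) / (product of the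
    steps), so uniform bounds on these quotients for small steps bound the
    derivative ([iter_partial_bounds]).  The increment over a box is its
    probability ([iter_diff_vector_cdf]); by the copula assumption this is the
    Gaussian measure of the box with corners the normal scores
    ([gaussian_copula_box]), which lies between the extreme values of phi_Sigma
    on that box times its volume ([mvnormal_prob_box_bounds]).  Each side of the
    box, divided by its step, tends to f_{i|y}(x_i) / phi(a_i), the derivative
    of Phi^-1 o F_{i|y} ([normal_score_quotient]).

    A score [a_i] is infinite only where F_{i|y} is 0 or 1.  There the
    distribution functions are constant on one side of the point, so both
    f^y(x) and f_{i|y}(x_i) vanish ([gaussian_copula_density_cases]).  Hence in
    all cases f^y(x) = 0 forces some f_{i|y}(x_i) = 0, and if one of the two
    joint densities is zero, both sides of the identity are the same infinite
    value. *)

(** * Iterated partial derivatives and box difference quotients *)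

Section iterated_differences.
Context {R : realType} {d : nat}.
Implicit Types (f : 'cV[R]_d -> R) (x : 'cV[R]_d) (s : seq 'I_d).
Implicit Types (ps : seq ('I_d * R)).

(** The head of [ps] is the outermost difference, in the order of
    [iter_partial]: the two recursions are then matched step by step. *)
Fixpoint iter_diff ps f x : R :=
  match ps with
  | [::] => f x
  | q :: ps' => iter_diff ps' f (x + q.2 *: unit_cv q.1) - iter_diff ps' f x
  end.

(** [side i] is the sign of the steps in direction [i].  Since the derivatives
    are two-sided limits, steps of one chosen sign suffice to compute them; the
    sign is chosen according to the point. *)
Definition steps_within (side : 'I_d -> bool) (e : R) ps :=
  forall q, q \in ps -> 0 < (-1) ^+ side q.1 * q.2 < e.

Let near_all (I : eqType) (L : seq I) (P : I -> R -> Prop)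
    (F : set_system R) : Filter F ->
  (forall p, p \in L -> \forall h \near F, P p h) ->
  \forall h \near F, forall p, p \in L -> P p h.
Proof.
move=> FF; elim: L => [|q L IH] H; first by near=> h.
near=> h; have Pq : P q h by near: h; apply: H; rewrite mem_head.
have PL : forall p, p \in L -> P p h.
  by near: h; apply: IH => p pL; apply: H; rewrite inE pL orbT.
by move=> p; rewrite inE => /predU1P[->|/PL].
Unshelve. all: by end_near. Qed.

Let cvg_sum_seq (I : eqType) (L : seq I) (u : I -> R -> R) (l : I -> R)
    (F : set_system R) : Filter F ->
  (forall p, p \in L -> u p h @[h --> F] --> l p) ->
  \sum_(p <- L) u p h @[h --> F] --> \sum_(p <- L) l p.
Proof.
move=> FF; elim: L => [_|q L IH H].
  by rewrite big_nil; under eq_fun do rewrite big_nil; exact: cvg_cst.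
rewrite big_cons; under eq_fun do rewrite big_cons.
apply: cvgD; first by apply: H; rewrite mem_head.
by apply: IH => p pL; apply: H; rewrite inE pL orbT.
Qed.

(** Replacing the outermost derivative by its difference quotient turns one
    value of an iterated derivative into a combination of two values of the
    inner one.  Hence the induction is on linear combinations, over a list [L]
    of weights and points.  If the derivative exceeded [B], so would some
    quotient with a small step of the prescribed sign. *)
Lemma iter_partial_le s f (side : 'I_d -> bool) (B e : R)
    (L : seq (R * 'cV[R]_d)) :
  0 < e ->
  (forall p, p \in L -> iter_partial_ex s f p.2) ->
  (forall ps, unzip1 ps = s -> steps_within side e ps ->
     (\sum_(p <- L) p.1 * iter_diff ps f p.2) / \prod_(q <- ps) q.2 <= B) ->
  \sum_(p <- L) p.1 * iter_partial s f p.2 <= B.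
Proof.
move=> e0; elim: s L => [|i s IH] L exL HB.
  by have := HB [::] erefl; rewrite big_nil divr1; apply => q; rewrite in_nil.
pose g h := \sum_(p <- L) p.1 *
  (h^-1 * (iter_partial s f (h *: unit_cv i + p.2) - iter_partial s f p.2)).
have gl : g h @[h --> 0^'] --> \sum_(p <- L) p.1 * iter_partial (i :: s) f p.2.
  apply: cvg_sum_seq => p pL; apply: cvgM; first exact: cvg_cst.
  by have [_] := exL _ pL.
rewrite leNgt; apply/negP => ltB.
have near_gt : \forall h \near 0^', B < g h by exact: cvgr_gt ltB.
have near_ex : \forall h \near (0 : R), forall p, p \in L ->
    iter_partial_ex s f (p.2 + h *: unit_cv i).
  apply: (@near_all _ L (fun p h => iter_partial_ex s f (p.2 + h *: unit_cv i)) (nbhs (0:R))) => p pL.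
  by case: (exL _ pL).
have ex0 p : p \in L -> iter_partial_ex s f p.2.
  by move=> pL; have := nbhs_singleton near_ex _ pL; rewrite scale0r addr0.
have {near_ex}near_ex := nbhs_dnbhs near_ex.
have [r /= r0 Hr] : \forall h \near 0^', B < g h /\ forall p, p \in L ->
    iter_partial_ex s f (p.2 + h *: unit_cv i) by exact: filterI.
(* The step h is small enough for Hr and has the sign that the bounds require. *)
pose t := Num.min e r / 2.
have t0 : 0 < t by rewrite divr_gt0// lt_min e0.
have [te tr] : t < e /\ t < r.
  by apply/andP; rewrite -lt_min /t ltr_pdivrMr// ltr_pMr ?ltr1n// lt_min e0.
pose h : R := (-1) ^+ side i * t.
have h0 : h != 0 by rewrite mulf_neq0 ?signr_eq0 ?gt_eqF.
have {Hr}[|gB exh] := Hr h _ h0.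
  by rewrite /= sub0r normrN /h normrM normr_sign mul1r gtr0_norm.
have hside : 0 < (-1) ^+ side i * h < e by rewrite /h mulrA -expr2 sqrr_sign mul1r t0.
pose L' := [seq (p.1 / h, p.2 + h *: unit_cv i) | p <- L] ++
           [seq (- (p.1 / h), p.2) | p <- L].
have sumL' (u : 'cV[R]_d -> R) : \sum_(p <- L') p.1 * u p.2 =
    (\sum_(p <- L) p.1 * (u (p.2 + h *: unit_cv i) - u p.2)) / h.
  rewrite big_cat !big_map /= -big_split /= mulr_suml.
  by apply: eq_bigr => p _; rewrite mulNr -mulrBr mulrAC.
suff : \sum_(p <- L') p.1 * iter_partial s f p.2 <= B.
  rewrite leNgt => /negP; apply; rewrite sumL' (lt_le_trans gB)// mulr_suml.
  by apply: ler_sum => p _; rewrite [_ *: _ + _]addrC mulrCA mulrC.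
apply: IH => [p|ps ps_s psP].
  rewrite mem_cat => /orP[] /mapP[p' p'L ->] /=; first exact: exh.
  exact: ex0.
rewrite sumL'; have := HB ((i, h) :: ps).
rewrite /= big_cons /= ps_s => /(_ erefl); rewrite invfM mulrA; apply => q.
by rewrite inE => /predU1P[->//|]; exact: psP.
Qed.

Lemma iter_partial_bounds s f x (side : 'I_d -> bool) (A B e : R) :
  0 < e -> iter_partial_ex s f x ->
  (forall ps, unzip1 ps = s -> steps_within side e ps ->
     A <= iter_diff ps f x / \prod_(q <- ps) q.2 <= B) ->
  A <= iter_partial s f x <= B.
Proof.
move=> e0 exs HAB; apply/andP; split.
  have := @iter_partial_le s f side (- A) e [:: (-1, x)] e0.
  rewrite big_seq1 mulN1r lerN2; apply => [p|ps ps_s psP].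
    by rewrite inE => /eqP ->.
  by rewrite big_seq1 mulN1r mulNr lerN2; case/andP: (HAB _ ps_s psP).
have := @iter_partial_le s f side B e [:: (1, x)] e0.
rewrite big_seq1 mul1r; apply => [p|ps ps_s psP].
  by rewrite inE => /eqP ->.
by rewrite big_seq1 mul1r; case/andP: (HAB _ ps_s psP).
Qed.

(** If [f] does not depend on coordinate [i] on the half-space from [c] in the
    direction of the steps, the difference in direction [i] is taken between
    equal values, wherever it occurs among the others. *)
Lemma iter_diff_eq0 f x (side : 'I_d -> bool) (e : R) (i : 'I_d) (c : R) :
  (forall (y : 'cV[R]_d) h, 0 <= (-1) ^+ side i * (y i ord0 - c) ->
     0 <= (-1) ^+ side i * h -> f (y + h *: unit_cv i) = f y) ->
  0 <= (-1) ^+ side i * (x i ord0 - c) ->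
  forall ps, i \in unzip1 ps -> steps_within side e ps -> iter_diff ps f x = 0.
Proof.
move=> fc; have inv ps (y : 'cV[R]_d) h : steps_within side e ps ->
    0 <= (-1) ^+ side i * (y i ord0 - c) -> 0 <= (-1) ^+ side i * h ->
    iter_diff ps f (y + h *: unit_cv i) = iter_diff ps f y.
  move=> + + h0; elim: ps y => [|q ps IH] y psP yc /=; first exact: fc.
  have psP' : steps_within side e ps.
    by move=> r rps; apply: psP; rewrite inE rps orbT.
  rewrite addrAC !IH//= !mxE !eqxx andbT addrAC mulrDr addr_ge0//.
  case: eqVneq => [iq|_]; last by rewrite mulr0 mulr0.
  by rewrite mulr1 iq ltW//; have /andP[] := psP _ (mem_head _ _).
move=> + ps; elim: ps x => [//|q ps IH] x xc /=; rewrite inE => ips psP.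
have psP' : steps_within side e ps.
  by move=> r rps; apply: psP; rewrite inE rps orbT.
have /andP[q0 _] := psP _ (mem_head _ _).
case/predU1P: ips => [iq|ips]; first by rewrite -iq inv ?subrr// iq ltW.
rewrite !IH ?subrr// !mxE !eqxx andbT addrAC mulrDr addr_ge0//.
by case: eqVneq => [iq|_]; rewrite ?mulr1 ?mulr0 ?mulr0// iq ltW.
Qed.

End iterated_differences.

(** * Probabilities of boxes *)

Section probability_facts.
Context {dT : measure_display} {T : measurableType dT} {R : realType}.
Context (Q : probability T R).
Implicit Types A B N : set T.

Lemma fine_probability_ge0 A : 0 <= fine (Q A).
Proof. exact: fine_ge0. Qed.

Lemma fine_probabilityD A B : measurable A -> measurable B -> B `<=` A ->
  fine (Q (A `\` B)) = fine (Q A) - fine (Q B).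
Proof.
move=> mA mB BA; rewrite -fineB ?fin_num_measure// measureD ?ltey_eq ?fin_num_measure//.
by rewrite (setIidr BA).
Qed.

Lemma fine_probability_le A B : measurable A -> measurable B -> A `<=` B ->
  fine (Q A) <= fine (Q B).
Proof.
by move=> mA mB AB; rewrite fine_le ?fin_num_measure// le_measure ?inE.
Qed.

Lemma measurable_forall (I : finType) (A : I -> set T) :
  (forall i, measurable (A i)) -> measurable [set w | forall i, A i w].
Proof.
move=> mA; rewrite (_ : mkset _ = \bigcap_(i in [set: I]) A i); last first.
  by apply/seteqP; split=> w Aw i //; exact: (Aw i).
by apply: fin_bigcap_measurable => // ; exact: finite_finset.
Qed.

Lemma measurable_le_event (V : T -> R) : measurable_fun [set: T] V ->
  forall c, measurable [set w | V w <= c].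
Proof.
move=> mV c; rewrite (_ : mkset _ = [set: T] `&` V @^-1` `]-oo, c]); first exact: mV.
by apply/seteqP; split=> w; rewrite /= in_itv/=; [split|case].
Qed.

Lemma measurable_gt_event (V : T -> R) : measurable_fun [set: T] V ->
  forall c, measurable [set w | c < V w].
Proof.
move=> mV c; rewrite (_ : mkset _ = [set: T] `&` V @^-1` `]c, +oo[); first exact: mV.
by apply/seteqP; split=> w; rewrite /= in_itv/= andbT; [split|case].
Qed.

(** The events need only agree up to null sets, coordinate by coordinate. *)
Lemma eq_probability_forall (I : finType) (A B : I -> set T) :
  (forall i, measurable (A i)) -> (forall i, measurable (B i)) ->
  (forall i, Q.-negligible (A i `\` B i)) ->
  (forall i, Q.-negligible (B i `\` A i)) ->
  Q [set w | forall i, A i w] = Q [set w | forall i, B i w].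
Proof.
suff le (C D : I -> set T) : (forall i, measurable (C i)) ->
    (forall i, measurable (D i)) -> (forall i, Q.-negligible (C i `\` D i)) ->
    (Q [set w | forall i, C i w] <= Q [set w | forall i, D i w])%E.
  by move=> mA mB AB BA; apply/eqP; rewrite eq_le !le.
move=> mC mD CD.
set C' := [set w | forall i, C i w]; set D' := [set w | forall i, D i w].
have mC' : measurable C' by exact: measurable_forall.
have mD' : measurable D' by exact: measurable_forall.
have CD'0 : Q (C' `\` D') = 0%E.
  apply/negligibleP; first exact: measurableD.
  apply: (@negligibleS _ _ _ _ (\big[setU/set0]_(i <- enum I) (C i `\` D i))).
    move=> w [Cw /existsNP[i Di]]; rewrite -bigcup_seq; exists i => //=.
    by rewrite mem_enum.
  apply: big_ind => [|M N|i _]; [exact: negligible_set0|exact: negligibleU|].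
  exact: CD.
have -> : Q C' = (Q (C' `\` D') + Q (C' `&` D'))%E by exact: measureDI.
rewrite CD'0 add0e le_measure ?inE//.
exact: measurableI.
Qed.

End probability_facts.

Section distribution_function_differences.
Context {dT : measure_display} {T : measurableType dT} {R : realType}.
Context (Q : probability T R) {d : nat} (U : 'I_d -> T -> R).
Context (mU : forall i, measurable_fun [set: T] (U i)).
Implicit Types (x : 'cV[R]_d) (ps : seq ('I_d * R)).

Definition vector_cdf x : R := fine (Q [set w | forall i, U i w <= x i ord0]).

Definition total_step ps : 'cV[R]_d := \sum_(q <- ps) q.2 *: unit_cv q.1.

(** What an increment of the distribution function in only some directions
    measures: a box in those directions, a lower orthant in the others. *)
Definition box_event ps x : set T :=
  [set w | (forall i, U i w <= (x + total_step ps) i ord0) /\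
           (forall q, q \in ps -> x q.1 ord0 < U q.1 w)].

Let measurable_box_event ps x : measurable (box_event ps x).
Proof.
have mle := measurable_forall
  (fun i => measurable_le_event (mU i) ((x + total_step ps) i ord0)).
suff mgt : measurable [set w | forall q, q \in ps -> x q.1 ord0 < U q.1 w].
  exact: (measurableI _ _ mle mgt).
elim: (ps) => [|q ps' IH].
  by rewrite (_ : [set w | _] = setT); [exact: measurableT|apply/seteqP; split].
rewrite (_ : [set w | _] = [set w | x q.1 ord0 < U q.1 w] `&`
  [set w | forall p, p \in ps' -> x p.1 ord0 < U p.1 w]); last first.
  apply/seteqP; split=> w /=.
    move=> H; split; first by apply: H; rewrite mem_head.
    by move=> p pps; apply: H; rewrite inE pps orbT.
  by move=> [H1 H2] p; rewrite inE => /predU1P[->|/H2].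
by apply: measurableI => //; exact: measurable_gt_event.
Qed.

Lemma total_step_notin ps i : i \notin unzip1 ps -> total_step ps i ord0 = 0.
Proof.
rewrite /total_step summxE => iN; rewrite big_seq big1// => q qps.
rewrite !mxE eqxx andbT; case: eqVneq => [iq|_]; last by rewrite mulr0.
by case/negP: iN; rewrite iq; apply: map_f.
Qed.

(** Each difference removes from an event the part where one more coordinate is
    at most its starting value. *)
Lemma iter_diff_vector_cdf ps x : uniq (unzip1 ps) ->
  (forall q, q \in ps -> 0 < q.2) ->
  iter_diff ps vector_cdf x = fine (Q (box_event ps x)).
Proof.
elim: ps x => [|[i h] ps IH] x /=.
  move=> _ _; congr (fine (Q _)); apply/seteqP; split=> w /=.
    move=> H; split=> [j|q]; last by rewrite in_nil.
    by rewrite /total_step big_nil addr0.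
  by move=> [H _] j; have := H j; rewrite /total_step big_nil addr0.
move=> /andP[iN ups] ps_gt0.
have h0 : 0 < h by apply: (ps_gt0 (i, h)); rewrite mem_head.
have ps_gt0' q : q \in ps -> 0 < q.2.
  by move=> qps; apply: ps_gt0; rewrite inE qps orbT.
have unitE j : (unit_cv i : 'cV[R]_d) j ord0 = (j == i)%:R.
  by rewrite mxE eqxx andbT.
have xE q : q \in ps -> (x + h *: unit_cv i) q.1 ord0 = x q.1 ord0.
  move=> qps; rewrite mxE [in X in _ + X]mxE unitE.
  case: eqVneq => [qi|_]; last by rewrite mulr0 addr0.
  by case/negP: iN; rewrite -qi; apply: map_f.
rewrite !IH// -fine_probabilityD//; last first.
  move=> w [H1 H2]; split=> [j|q qps]; last by rewrite xE//; exact: H2.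
  apply: (le_trans (H1 j)); rewrite !mxE lerD2r lerDl.
  by rewrite mulr_ge0 ?ler0n ?ltW.
congr (fine (Q _)).
have tE : total_step ((i, h) :: ps) = h *: unit_cv i + total_step ps.
  by rewrite /total_step big_cons.
apply/seteqP; split=> w /=.
  move=> [[H1 H2] H3]; split.
    by move=> j; rewrite tE addrA; exact: H1.
  move=> q; rewrite inE => /predU1P[->/=|qps]; last by rewrite -xE//; exact: H2.
  rewrite ltNge; apply/negP => Ux; apply: H3; split=> [j|q' q'ps]; last first.
    by rewrite -xE//; exact: H2.
  have [->|ji] := eqVneq j i; first by rewrite mxE total_step_notin// addr0.
  have := H1 j; rewrite !mxE (negbTE ji) mulr0 addr0.
  by [].
move=> [H1 H2]; split.
  split=> [j|q qps]; first by rewrite -addrA -tE; exact: H1.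
  by rewrite xE//; apply: H2; rewrite inE qps orbT.
move=> [H3 _]; have := H3 i; rewrite mxE total_step_notin// addr0 leNgt.
by rewrite (H2 (i, h)) ?mem_head.
Qed.

End distribution_function_differences.

(** * Distribution functions on the line *)

Section real_cdf.
Context {dT : measure_display} {T : measurableType dT} {R : realType}.
Context (Q : probability T R) (V : T -> R) (mV : measurable_fun [set: T] V).

Definition real_cdf (c : R) : R := fine (Q [set w | V w <= c]).

Let V_mfun : {mfun T >-> R} := mfun_Sub (mem_set mV).

Let real_cdfE c : real_cdf c = fine (@cdf _ T R Q V_mfun c).
Proof.
congr (fine (Q _)); apply/seteqP; split=> w /=; by rewrite in_itv.
Qed.

Lemma real_cdf_nondecreasing : {homo real_cdf : a b / a <= b}.
Proof.
move=> a b ab; rewrite !real_cdfE fine_le ?fin_num_measure//.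
exact: cdf_nondecreasing.
Qed.

Lemma real_cdf_ge0 c : 0 <= real_cdf c. Proof. exact: fine_ge0. Qed.

Lemma real_cdf_le1 c : real_cdf c <= 1.
Proof.
by rewrite real_cdfE -lee_fin fineK ?fin_num_measure// probability_le1.
Qed.

Lemma real_cdf_gt_near_pinfty p : p < 1 -> exists c, p < real_cdf c.
Proof.
move=> p1; have /fine_cvgP[_ F1] := @cvg_cdfy1 _ T R Q V_mfun.
have : \forall c \near +oo, p < (fine \o cdf (P:=Q) V_mfun) c.
  exact: (cvgr_gt _ F1).
by move=> /(@filter_ex _ _ _)[c pc]; exists c; rewrite real_cdfE.
Qed.

Lemma real_cdf_lt_near_ninfty p : 0 < p -> exists c, real_cdf c < p.
Proof.
move=> p0; have /fine_cvgP[_ F1] := @cvg_cdfNy0 _ T R Q V_mfun.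
have : \forall c \near -oo, (fine \o cdf (P:=Q) V_mfun) c < p.
  exact: (cvgr_lt _ F1).
by move=> /(@filter_ex _ _ _)[c pc]; exists c; rewrite real_cdfE.
Qed.

Lemma continuous_cdf_onto p : continuous real_cdf -> 0 < p < 1 ->
  exists c, real_cdf c = p.
Proof.
move=> cF /andP[p0 p1].
have [a ap] := real_cdf_lt_near_ninfty p0.
have [b pb] := real_cdf_gt_near_pinfty p1.
have ab : a <= b.
  rewrite leNgt; apply/negP => /ltW/real_cdf_nondecreasing.
  by rewrite leNgt (lt_trans ap).
have [||c _ cp] := @IVT R real_cdf a b p ab; last by exists c.
  by apply: continuous_subspaceT => z; exact: cF.
by rewrite minElt maxElt (lt_trans ap pb) !ltW.
Qed.

(** If [F c = 1], nothing lies beyond [c].  Otherwise, by the intermediate value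
    theorem, there is for each small [r > 0] a point [t] with [F t = F c + r],
    and the event lies in [c < V <= t], of probability [r]. *)
Lemma cdf_level_negligible c : continuous real_cdf ->
  Q.-negligible [set w | c < V w /\ real_cdf (V w) <= real_cdf c].
Proof.
move=> cF; set N := [set w | _].
have mF : measurable_fun [set: T] (real_cdf \o V).
  by apply: measurableT_comp => //; exact: continuous_measurable_fun.
have mN : measurable N.
  by apply: measurableI; [exact: measurable_gt_event|exact: (measurable_le_event mF)].
apply/negligibleP => //; apply/eqP; rewrite eq_le measure_ge0 andbT.
rewrite -(fineK (fin_num_measure Q _ mN)) lee_fin.
have mle a := measurable_le_event mV a.
apply/ler_addgt0Pr => e e0; rewrite add0r.
have := real_cdf_le1 c; rewrite le_eqVlt => /predU1P[c1|c_lt1].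
  apply: (@le_trans _ _ (fine (Q ([set: T] `\` [set w | V w <= c])))).
    apply: fine_probability_le => //; first exact: measurableD.
    by move=> w [cV _]; split => //=; apply/negP; rewrite -ltNge.
  rewrite fine_probabilityD// probability_setT /=.
  by rewrite -/(real_cdf c) c1 subrr ltW.
pose r := Num.min e (1 - real_cdf c) / 2.
have r_gt0 : 0 < r by rewrite divr_gt0// lt_min e0 subr_gt0.
have /andP[re r1] : (r < e) && (r < 1 - real_cdf c).
  by rewrite -lt_min /r ltr_pdivrMr// ltr_pMr ?ltr1n// lt_min e0 subr_gt0.
have [|t tE] := @continuous_cdf_onto (real_cdf c + r) cF.
  by rewrite addrC ltr_wpDr ?real_cdf_ge0//= -ltrBrDr.
have ct : real_cdf c < real_cdf t by rewrite tE ltrDl.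
apply: (@le_trans _ _ (fine (Q ([set w | V w <= t] `\` [set w | V w <= c])))).
  apply: fine_probability_le => //; first exact: measurableD.
  move=> w [cV Vc]; split => /=; last by apply/negP; rewrite -ltNge.
  rewrite leNgt; apply/negP => /ltW/real_cdf_nondecreasing.
  by rewrite leNgt (le_lt_trans Vc).
rewrite fine_probabilityD//; last first.
  move=> w /= /le_trans; apply; rewrite leNgt; apply/negP => /ltW.
  by move=> /real_cdf_nondecreasing; rewrite leNgt ct.
by rewrite -/(real_cdf t) -/(real_cdf c) tE addrAC subrr add0r ltW.
Qed.

End real_cdf.

Section standard_normal.
Context {R : realType}.
Local Notation phi := (normal_pdf (0 : R) 1).

Lemma PhiE (t : R) : Phi t = real_cdf (normal_prob (0 : R) 1) id t.
Proof. by congr (fine (normal_prob _ _ _)); apply/seteqP; split=> w; rewrite /= in_itv. Qed.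

Lemma phiE (t : R) : phi t = normal_peak 1 * expR (- t ^+ 2 / 2).
Proof.
by rewrite normal_pdfE ?oner_eq0// /normal_fun subr0 expr1n.
Qed.

Lemma phi_gt0 (t : R) : 0 < phi t.
Proof. by rewrite phiE mulr_gt0 ?expR_gt0 ?normal_peak_gt0 ?oner_eq0. Qed.

Lemma is_derive_Phi (t : R) : is_derive t 1 Phi (phi t).
Proof.
have := @continuous_FTC1 R phi -oo%O t (t + 1).
case=> [||||dF F'].
- by rewrite ltrDl.
- by apply: (integrableS _ _ (@subsetT _ _) (integrable_normal_pdf _ _)) => //.
- by rewrite ltNyr.
- by apply: continuous_normal_pdf; rewrite oner_eq0.
- apply: DeriveDef; first exact: dF.
  by rewrite -derive1E; exact: F'.
Qed.

Lemma continuous_Phi : continuous (@Phi R).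
Proof.
move=> t; apply: differentiable_continuous; apply/derivable1_diffP.
by have [] := is_derive_Phi t.
Qed.

Lemma Phi_lt : {homo (@Phi R) : a b / a < b}.
Proof.
move=> a b ab; have [|c _ E] := @MVT R Phi phi a b ab (fun t _ => is_derive_Phi t).
  by apply: continuous_subspaceT => z; exact: continuous_Phi.
rewrite -subr_gt0 E. by rewrite mulr_gt0 ?phi_gt0 ?subr_gt0.
Qed.

Lemma Phi_le : {mono (@Phi R) : a b / a <= b}.
Proof. exact: le_mono Phi_lt. Qed.

(** [Phi] is continuous, so the infimum that defines a finite quantile is
    attained.  This adjunction is all that is used of the quantile function, apart from
    [PhiK]; it also covers the levels 0 and 1, of infinite quantile. *)
Lemma Phi_inv_le (p b : R) : (Phi_inv p <= b%:E)%E = (p <= Phi b).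
Proof.
apply/idP/idP => [|pb]; last by apply: ereal_inf_lbound; exists b.
apply: contraTT; rewrite -!ltNge => bp.
have : \forall t \near b, Phi t < p by exact: (cvgr_lt _ (continuous_Phi (x := b))).
move=> /nbhs_ballP[e /= e0 He].
have : Phi (b + e / 2) < p.
  apply: He; rewrite /ball /= opprD addrA subrr sub0r normrN gtr0_norm ?divr_gt0//.
  by rewrite ltr_pdivrMr// ltr_pMr// ltr1n.
move=> be; apply: (@lt_le_trans _ _ (b + e / 2)%:E).
  by rewrite lte_fin ltrDl divr_gt0.
apply/ereal_infP => _ [t /= pt <-]; rewrite lee_fin -Phi_le.
by rewrite (le_trans (ltW be)).
Qed.

Lemma PhiK (t : R) : Phi_inv (Phi t) = t%:E.
Proof.
apply/eqP; rewrite eq_le Phi_inv_le lexx /=.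
by apply/ereal_infP => _ [u /= tu <-]; rewrite lee_fin -Phi_le.
Qed.

Lemma Phi_onto (p : R) : 0 < p < 1 -> exists t, Phi t = p.
Proof.
move=> p01; have [||c] := @continuous_cdf_onto _ _ R (normal_prob 0 1) id _ p _ p01.
- exact: measurable_id.
- rewrite (_ : real_cdf _ _ = Phi); first exact: continuous_Phi.
  by apply/funext => t; rewrite PhiE.
- by rewrite -PhiE => cp; exists c.
Qed.

Lemma Phi_gt0 (t : R) : 0 < Phi t.
Proof.
apply: (le_lt_trans _ (Phi_lt (_ : t - 1 < t))); last by rewrite ltrBlDr ltrDl.
by rewrite PhiE real_cdf_ge0.
Qed.

Lemma Phi_lt1 (t : R) : Phi t < 1.
Proof.
apply: (lt_le_trans (Phi_lt (_ : t < t + 1))); first by rewrite ltrDl.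
by rewrite PhiE real_cdf_le1//.
Qed.

End standard_normal.

(** * Gaussian measure of a small box *)

Section iterated_lebesgue_integral.
Context {R : realType}.
Local Notation mu := (@lebesgue_measure R).
Local Open Scope ereal_scope.

(** The integral of any nonnegative function is the supremum of the integrals of
    the simple functions below it, so it is monotone on all such functions.  For
    this reason iterated integrals can be compared without studying the
    measurability of the partial integrals. *)
Lemma ge0_le_integralT (f g : R -> \bar R) : (forall t, 0 <= f t) ->
  (forall t, f t <= g t) -> \int[mu]_(t in [set: R]) f t <= \int[mu]_(t in [set: R]) g t.
Proof.
move=> f0 fg; rewrite !ge0_integralTE//; last by move=> t; exact: le_trans (fg t).
by apply: ereal_sup_le => _ [h hf <-]; exists h => // t; exact: le_trans (fg t).
Qed.

Lemma lebesgue_integral_tuple_ge0 d (f : d.-tuple R -> \bar R) :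
  (forall z, 0 <= f z) -> 0 <= lebesgue_integral_tuple f.
Proof.
elim: d f => [|d IH] f f0 /=; first exact: f0.
by apply: integral_ge0 => t _; exact: IH.
Qed.

Lemma le_lebesgue_integral_tuple d (f g : d.-tuple R -> \bar R) :
  (forall z, 0 <= f z) -> (forall z, f z <= g z) ->
  lebesgue_integral_tuple f <= lebesgue_integral_tuple g.
Proof.
elim: d f g => [|d IH] f g f0 fg /=; first exact: fg.
apply: ge0_le_integralT => t; last exact: IH.
exact: lebesgue_integral_tuple_ge0.
Qed.

Definition tuple_box d (a b : 'I_d -> R) : set (d.-tuple R) :=
  [set z | forall i, (a i < tnth z i <= b i)%R].

Lemma lebesgue_integral_tuple_box d (a b : 'I_d -> R) (c : R) : (0 <= c)%R ->
  (forall i, (a i <= b i)%R) ->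
  lebesgue_integral_tuple (fun z => (c * \1_(tuple_box a b) z)%:E) =
  (c * \prod_i (b i - a i))%:E.
Proof.
elim: d a b c => [|d IH] a b c c0 ab /=.
  rewrite big_ord0 indicE mem_set//.
  by case.
pose a' i := a (lift ord0 i); pose b' i := b (lift ord0 i).
transitivity (\int[mu]_(t in [set: R])
   ((c * \prod_i (b' i - a' i))%:E * (\1_(`]a ord0, b ord0]%classic) t)%:E)).
  apply: eq_integral => t _.
  rewrite -EFinM mulrAC -IH ?mulr_ge0 //; last by move=> i; exact: ab.
  congr lebesgue_integral_tuple; apply/funext => z; congr EFin.
  rewrite -mulrA; congr (_ * _)%R; rewrite !indicE -natrM mulnb; congr (nat_of_bool _)%:R.
  apply/idP/andP => [|[]]; rewrite !inE /= in_itv/=.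
    move=> H; split; first by have := H ord0; rewrite tnth0.
    by move=> i; have := H (lift ord0 i); rewrite tnthS.
  move=> H0 HS i; case: (unliftP ord0 i) => [j ->|->]; last by rewrite tnth0.
  by rewrite tnthS; exact: HS.
rewrite ge0_integralZl//; last 2 first.
- by apply/measurable_EFinP; exact: measurable_indic.
- rewrite lee_fin mulr_ge0// prodr_ge0// => i _.
  by rewrite subr_ge0 ab.
rewrite integral_indic// setIT.
rewrite [X in _ * X](_ : _ = (b ord0 - a ord0)%:E); last first.
  apply: (etrans (lebesgue_measure_itv `]a ord0, b ord0])).
  rewrite /= lte_fin -EFinD.
  case: ltP => [//|ba].
  by have -> : a ord0 = b ord0 by [apply/eqP; rewrite eq_le ab]; rewrite subrr.
by rewrite big_ord_recl -EFinM mulrA mulrAC.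
Qed.

Lemma mvnormal_prob_box_bounds d (Sigma : 'M[R]_d) (a b : 'I_d -> R) (m M : R) :
  (0 <= m)%R -> (0 <= M)%R -> (forall i, (a i <= b i)%R) ->
  (forall z, tuple_box a b z -> (m <= mvnormal_pdf Sigma z <= M)%R) ->
  (m * \prod_i (b i - a i))%:E <= mvnormal_prob Sigma (tuple_box a b)
  <= (M * \prod_i (b i - a i))%:E.
Proof.
move=> m0 M0 ab pdf; rewrite -!lebesgue_integral_tuple_box //.
apply/andP; split; apply: le_lebesgue_integral_tuple => z; rewrite lee_fin indicE.
- by rewrite mulr_ge0.
- case: (boolP (z \in _)); rewrite ?mulr0// inE !mulr1 => /pdf.
  by case/andP.
- case: (boolP (z \in _)); rewrite ?mulr0// inE !mulr1 => /pdf /andP[+ _].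
  exact: le_trans.
- case: (boolP (z \in _)); rewrite ?mulr0// inE !mulr1 => /pdf /andP[_ zM].
  by [].
Qed.

End iterated_lebesgue_integral.

(** * The joint density under a Gaussian copula *)

Section continuity_facts.
Context {R : realType}.

(** Passage to the limit in the family of bounds indexed by [e]. *)
Lemma continuous_at0_le (f : R -> R) (v : R) : {for 0, continuous f} ->
  (forall e, 0 < e -> f e <= v) -> f 0 <= v.
Proof.
move=> cf fv; rewrite leNgt; apply/negP => v_lt.
have /nbhs_ballP[r /= r0 Hr] : \forall e \near (0 : R), v < f e by exact: (cvgr_gt _ cf).
have := Hr (r / 2); rewrite /ball /= sub0r normrN gtr0_norm ?divr_gt0//.
rewrite ltr_pdivrMr// ltr_pMr// ltr1n => /(_ isT).
by rewrite ltNge fv// divr_gt0.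
Qed.

(** As for [iter_partial_bounds], quotients on one side determine the sign. *)
Lemma derive1_ge0 (f : R -> R) (x e : R) (side : bool) :
  0 < e -> derivable f x 1 ->
  (forall h, 0 < (-1) ^+ side * h < e -> 0 <= (f (x + h) - f x) / h) ->
  0 <= f^`()%classic x.
Proof.
move=> e0 df fh; rewrite leNgt; apply/negP => df_lt0.
have [r /= r0 Hr] : \forall h \near 0^', (f (x + h) - f x) / h < 0.
  apply: (cvgr_lt (f^`()%classic x)) => //.
  rewrite (_ : (fun h => _) = (fun h => h^-1 *: ((f \o shift x) (h *: (1:R)) - f x))).
    by rewrite derive1E; exact: df.
  by apply/funext => h /=; rewrite [h *: _]mulr1 [h + x]addrC [_ *: _]mulrC.
have t0 : 0 < Num.min e r / 2 by rewrite divr_gt0// lt_min e0.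
have /andP[te tr] : (Num.min e r / 2 < e) && (Num.min e r / 2 < r).
  by rewrite -lt_min ltr_pdivrMr// ltr_pMr ?ltr1n// lt_min e0.
have := Hr ((-1) ^+ side * (Num.min e r / 2)); rewrite /= sub0r normrN normrM.
rewrite normr_sign mul1r gtr0_norm// mulf_neq0 ?signr_eq0 ?gt_eqF// => /(_ tr isT).
by rewrite ltNge fh// mulrA -expr2 sqrr_sign mul1r t0.
Qed.

Lemma derive1_eq0 (f : R -> R) (x : R) (side : bool) :
  derivable f x 1 -> (forall h, 0 < (-1) ^+ side * h -> f (x + h) = f x) ->
  f^`()%classic x = 0.
Proof.
move=> df fh; apply/eqP; rewrite eq_le -oppr_ge0 derive1E -deriveN// -!derive1E.
apply/andP; split; apply: (@derive1_ge0 _ _ 1 side) => //.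
- exact: derivableN.
- by move=> h /andP[/fh E _] /=; rewrite /= -[(- f) _]/(- f _) E opprK addNr mul0r.
- by move=> h /andP[/fh -> _]; rewrite subrr mul0r.
Qed.

Lemma nondecreasing_derive1_ge0 (f : R -> R) (x : R) :
  {homo f : s t / s <= t} -> derivable f x 1 -> 0 <= f^`()%classic x.
Proof.
move=> fle df; apply: (@derive1_ge0 _ _ 1 false) => // h.
by rewrite mul1r => /andP[h0 _]; rewrite divr_ge0 ?(ltW h0)// subr_ge0 fle// lerDl ltW.
Qed.

Lemma continuous_mul {T : topologicalType} (f g : T -> R) :
  continuous f -> continuous g -> continuous (fun x => f x * g x).
Proof. by move=> cf cg x; exact: cvgM (cf x) (cg x). Qed.

Let continuous_sum {T : topologicalType} (I : finType) (F : I -> T -> R) :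
  (forall i, continuous (F i)) -> continuous (fun x => \sum_i F i x).
Proof.
move=> cF; apply: continuous_big => [|i _]; first exact: add_continuous.
exact: cF.
Qed.

Lemma continuous_prod {T : topologicalType} (I : finType) (F : I -> T -> R) :
  (forall i, continuous (F i)) -> continuous (fun x => \prod_i F i x).
Proof.
move=> cF; apply: continuous_big => [|i _]; first exact: mul_continuous.
exact: cF.
Qed.

Lemma mvnormal_pdf_continuous d (Sigma : 'M[R]_d) (a : d.-tuple R) (e : R) :
  0 < e -> exists2 r, 0 < r & forall z : d.-tuple R,
    (forall i, `|tnth z i - tnth a i| < r) ->
    `|mvnormal_pdf Sigma z - mvnormal_pdf Sigma a| < e.
Proof.
move=> e0.
pose quad (v : 'cV[R]_d) : R := (v^T *m invmx Sigma *m v) ord0 ord0.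
have cquad : continuous quad.
  have -> : quad = fun v : 'cV[R]_d =>
      \sum_j (\sum_i v i ord0 * invmx Sigma i j) * v j ord0.
    apply/funext => v; rewrite /quad mxE; apply: eq_bigr => j _.
    by rewrite mxE; congr (_ * _); apply: eq_bigr => i _; rewrite mxE.
  have coordc i : continuous (fun v : 'cV[R]_d => v i ord0).
    exact: coord_continuous.
  apply: continuous_sum => j; apply: continuous_mul; last exact: coordc.
  apply: continuous_sum => i; apply: continuous_mul; first exact: coordc.
  exact: cst_continuous.
pose pdf (v : 'cV[R]_d) : R :=
  (Num.sqrt ((2 * pi) ^+ d * \det Sigma))^-1 * expR (- quad v / 2).
have cexp : continuous (fun v => - quad v / 2).
  apply: continuous_mul; last exact: cst_continuous.
  by move=> v; exact: (continuousN (cquad v)).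
have cpdf : continuous pdf.
  apply: continuous_mul; first exact: cst_continuous.
  by move=> v; apply: (continuous_comp (cexp v)); exact: continuous_expR.
pose vec (z : d.-tuple R) : 'cV[R]_d := \col_(i < d) tnth z i.
have : \forall v \near vec a, `|pdf (vec a) - pdf v| < e.
  by apply: (@cvgr_dist_lt R R _ _ _ pdf _ (cpdf (vec a))).

move=> /nbhs_ballP[r /= r0 Hr]; exists r => // z za.
rewrite distrC; apply: (Hr (vec z)); split => // i j.
by rewrite /ball /= !mxE distrC.
Qed.

End continuity_facts.

Section normal_scores.
Context {R : realType}.

(** The derivative of [Phi^-1 o G] at [x], by the chain rule and the derivative
    of an inverse function, together with the continuity that keeps the box of
    normal scores close to [a]. *)
Lemma normal_score_quotient (G : R -> R) (x a e : R) :
  continuous G -> {homo G : s t / s <= t} -> derivable G x 1 ->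
  Phi a = G x -> 0 < e ->
  exists2 r, 0 < r & forall h, 0 < h < r -> exists b,
    [/\ Phi b = G (x + h), a <= b < a + e &
        `|(b - a) / h - G^`()%classic x / normal_pdf 0 1 a| < e].
Proof.
move=> cG Gle dG aG e0.
pose s := (fine \o Phi_inv) \o G.
have PhiK' : cancel Phi (fine \o @Phi_inv R) by move=> t /=; rewrite PhiK.
have dinv : is_derive (G x) 1 (fine \o @Phi_inv R) (normal_pdf 0 1 a)^-1.
  rewrite -aG; apply: (@is_derive_inverse R Phi).
  - by near=> t; exact: PhiK'.
  - by near=> t; exact: continuous_Phi.
  - exact: is_derive_Phi.
  - by rewrite gt_eqF// phi_gt0.
have ds : is_derive x 1 s (G^`()%classic x / normal_pdf 0 1 a).
  rewrite mulrC; apply: is_derive1_comp; rewrite derive1E.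
  by apply: derivableP.
have sx : s x = a by rewrite /s /= -aG PhiK.
have cs : {for x, continuous s}.
  by apply: differentiable_continuous; apply/derivable1_diffP; case: ds.
have near_s : \forall t \near x, `|a - s t| < e.
  by rewrite -sx; exact: (cvgr_dist_lt _ _ cs).
have near_G : \forall t \near x, 0 < G t < 1.
  near=> t; apply/andP; split; near: t.
    by apply: (cvgr_gt _ (cG x)); rewrite -aG Phi_gt0.
  by apply: (cvgr_lt _ (cG x)); rewrite -aG Phi_lt1.
have near_q : \forall h \near 0^',
    `|G^`()%classic x / normal_pdf 0 1 a - (s (x + h) - a) / h| < e.
  apply: (cvgr_dist_lt _ _ _ _ e0).
  rewrite (_ : (fun h => _) =
    (fun h => h^-1 *: ((s \o shift x) (h *: (1:R)) - s x))).
    by have [? <-] := ds.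
  by apply/funext => h /=; rewrite sx [h *: _]mulr1 [h + x]addrC [_ *: _]mulrC.
have [r1 /= r10 H1] : \forall t \near x, `|a - s t| < e /\ 0 < G t < 1 by exact: filterI.
have [r2 /= r20 H2] := near_q.
exists (Num.min r1 r2); first by rewrite lt_min r10.
move=> h /andP[h0]; rewrite lt_min => /andP[hr1 hr2].
have [|sa G01] := H1 (x + h).
  by rewrite /= opprD addrA subrr sub0r normrN gtr0_norm.
have [b bG] := Phi_onto G01.
have sb : s (x + h) = b by rewrite /s /= -bG PhiK.
have ab : a <= b by rewrite -Phi_le aG bG Gle// lerDl ltW.
exists b; split => //.
  rewrite ab /= -ltrBlDl; apply: le_lt_trans sa.
  by rewrite sb distrC ler_norm.
rewrite distrC -sb; apply: H2; last by rewrite gt_eqF.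
by rewrite /= sub0r normrN gtr0_norm.
Unshelve. all: by end_near. Qed.

End normal_scores.

Section gaussian_copula_density.
Context {dT : measure_display} {T : measurableType dT} {R : realType}.
Context (Q : probability T R) {d : nat} (U : 'I_d -> T -> R).
Context (mU : forall i, measurable_fun [set: T] (U i)).
Context (cU : forall i, continuous (real_cdf Q (U i))).
Implicit Types (x : 'cV[R]_d) (ps : seq ('I_d * R)).

Local Notation F := (vector_cdf Q U).
Local Notation G i := (real_cdf Q (U i)).

Lemma measurable_tuple_box (a b : 'I_d -> R) : measurable (tuple_box a b).
Proof.
suff mi i : measurable [set z : d.-tuple R | a i < tnth z i <= b i].
  exact: measurable_forall mi.
have -> : [set z : d.-tuple R | a i < tnth z i <= b i] =
    [set z | a i < tnth z i] `&` [set z | tnth z i <= b i].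
  by apply/seteqP; split=> z; [case/andP|case=> *; apply/andP].
have mi := @measurable_tnth _ R d i.
by apply: measurableI; [exact: measurable_gt_event|exact: measurable_le_event].
Qed.

(** The copula property of the model, for the law [Q] of one class. *)
Definition has_gaussian_copula (Sigma : 'M[R]_d) : Prop :=
  forall B : set (d.-tuple R), measurable B ->
    (fine (Q [set w | exists2 z, B z &
       forall i, Phi_inv (G i (U i w)) = (tnth z i)%:E]))%:E =
    mvnormal_prob Sigma B.

(** The adjunction [Phi_inv_le] turns the condition on the scores of [U] into
    one on the values [G i (U i w)]; this differs from the condition on [U i w]
    itself only on level sets of [G i], which are null. *)
Lemma gaussian_copula_box Sigma (x y a b : 'I_d -> R) :
  has_gaussian_copula Sigma ->
  (forall i, Phi (a i) = G i (x i)) -> (forall i, Phi (b i) = G i (y i)) ->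
  (forall i, x i <= y i) ->
  (fine (Q [set w | forall i, x i < U i w <= y i]))%:E =
  mvnormal_prob Sigma (tuple_box a b).
Proof.
move=> cop aG bG xy; rewrite -cop; last exact: measurable_tuple_box.
pose A i := [set w | x i < U i w <= y i].
pose B i := [set w | G i (x i) < G i (U i w) <= G i (y i)].
have mGU i : measurable_fun [set: T] (G i \o U i).
  by apply: measurableT_comp => //; exact: continuous_measurable_fun.
have mA i : measurable (A i).
  rewrite (_ : A i = [set w | x i < U i w] `&` [set w | U i w <= y i]).
    by apply: measurableI; [exact: measurable_gt_event|exact: measurable_le_event].
  by apply/seteqP; split=> z; [case/andP|case=> *; apply/andP].
have mB i : measurable (B i).
  rewrite (_ : B i = [set w | G i (x i) < (G i \o U i) w] `&`
                     [set w | (G i \o U i) w <= G i (y i)]).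
    by apply: measurableI; [exact: measurable_gt_event|exact: measurable_le_event].
  by apply/seteqP; split=> z; [case/andP|case=> *; apply/andP].
have Gle i := real_cdf_nondecreasing Q (mU i).
congr (fine _)%:E.
have -> : [set w | exists2 z, tuple_box a b z &
    forall i, Phi_inv (G i (U i w)) = (tnth z i)%:E] = [set w | forall i, B i w].
  apply/seteqP; split=> w /=.
    move=> [z zab zE] i; have /andP[az zb] := zab i.
    rewrite /B /= -aG -bG ltNge -!Phi_inv_le zE !lee_fin zb andbT.
    by rewrite -ltNge.
  move=> Bw; have Phi_ontoU i : exists t, Phi t = G i (U i w).
    have /andP[xU Uy] := Bw i.
    apply: Phi_onto; rewrite (le_lt_trans _ xU) ?real_cdf_ge0//=.
    by rewrite (le_lt_trans Uy)// -bG Phi_lt1.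
  have [t tE] := choice Phi_ontoU; exists [tuple t i | i < d].
    move=> i; rewrite tnth_mktuple; have /andP[xU Uy] := Bw i.
    apply/andP; split; last by rewrite -Phi_le tE bG.
    by rewrite ltNge -Phi_le tE aG -ltNge.
  by move=> i; rewrite tnth_mktuple -tE PhiK.
apply: eq_probability_forall => // i.
  refine (negligibleS _ (cdf_level_negligible (mU i) (x i) (@cU i))).
  move=> w [/andP[xU Uy] NB]; split => //.
  rewrite leNgt; apply/negP => GxU; apply: NB; rewrite /B /= GxU /=.
  exact: Gle.
refine (negligibleS _ (cdf_level_negligible (mU i) (y i) (@cU i))).
move=> w [/andP[GxU GUy] NA]; split => //.
rewrite ltNge; apply/negP => Uy; apply: NA; rewrite /A /= Uy andbT.
by rewrite ltNge; apply/negP => Ux; move: GxU; rewrite ltNge Gle.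
Qed.

Lemma box_event_full ps x : unzip1 ps = enum 'I_d ->
  let h i := total_step ps i ord0 in
  [/\ forall i, (i, h i) \in ps,
      \prod_(q <- ps) q.2 = \prod_i h i &
      box_event U ps x = [set w | forall i, x i ord0 < U i w <= x i ord0 + h i]].
Proof.
move=> psE h.
have ups : uniq (unzip1 ps) by rewrite psE enum_uniq.
have hE q : q \in ps -> h q.1 = q.2.
  rewrite /h; elim: (ps) ups => // r ps' IH /= /andP[rN ups'].
  rewrite inE /total_step big_cons mxE => /predU1P[->|qps].
    by rewrite !mxE !eqxx mulr1 -/(total_step ps') total_step_notin// addr0.
  rewrite -/(total_step ps') IH// !mxE; case: eqVneq => [qr|_]; last first.
    by rewrite mulr0 add0r.
  by case/negP: rN; rewrite -qr; apply: map_f.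
have inps i : (i, h i) \in ps.
  have : i \in unzip1 ps by rewrite psE mem_enum.
  by move=> /mapP[[j r] jr /= ->]; rewrite (hE _ jr).
split => //.
  rewrite -big_enum -psE big_map big_seq [RHS]big_seq.
  by apply: eq_bigr => q /hE.
apply/seteqP; split=> w /=.
  move=> [H1 H2] i; rewrite (H2 _ (inps i)) /=.
  by have := H1 i; rewrite mxE.
move=> H; split=> [i|q qps]; first by rewrite mxE; case/andP: (H i).
by case/andP: (H q.1).
Qed.

Section at_a_point.
Context (Sigma : 'M[R]_d) (x : 'cV[R]_d) (a : 'I_d -> R).
Context (cop : has_gaussian_copula Sigma).
Context (aG : forall i, Phi (a i) = G i (x i ord0)).
Context (dG : forall i, derivable (G i) (x i ord0) 1).
Context (exF : mixed_partial_ex F x).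

Let p : R := mvnormal_pdf Sigma [tuple a i | i < d].
Let q i : R := (G i)^`()%classic (x i ord0) / normal_pdf 0 1 (a i).

Let p_ge0 : 0 <= p.
Proof. by rewrite /p /mvnormal_pdf mulr_ge0 ?expR_ge0// invr_ge0 sqrtr_ge0. Qed.

(** For steps small enough, the density stays within [e] of [p] on the box of
    scores and the quotients of the scores stay within [e] of the [q i].  The
    truncations at 0 keep the lower factors nonnegative, so that the
    inequalities can be multiplied. *)
Let mixed_partial_bounds e : 0 < e ->
  Num.max (p - e) 0 * \prod_i Num.max (q i - e) 0 <= mixed_partial F x <=
  (p + e) * \prod_i (q i + e).
Proof.
move=> e0.
have [r r0 pdf_near] := mvnormal_pdf_continuous Sigma [tuple a i | i < d] e0.
have re0 : 0 < Num.min r e by rewrite lt_min r0.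
have /choice[s s_near] : forall i, exists s, 0 < s /\ forall h, 0 < h < s ->
    exists b, [/\ Phi b = G i (x i ord0 + h), a i <= b < a i + Num.min r e &
      `|(b - a i) / h - q i| < Num.min r e].
  move=> i; have Gle := real_cdf_nondecreasing Q (mU i).
  have [s s0 sP] := normal_score_quotient (@cU i) Gle (@dG i) (aG i) re0.
  by exists s.
(* Starting the minimum at 1 covers d = 0. *)
pose s0 := \big[Num.min/1]_i s i.
have s0_gt0 : 0 < s0 by apply/bigmin_gtP; split => // i _; case: (s_near i).
have s0_le i : s0 <= s i by exact: bigmin_le.
apply: (@iter_partial_bounds _ _ _ _ _ (fun=> false) _ _ s0) => // ps psE ps_small.
have {ps_small} ps_small t : t \in ps -> 0 < t.2 < s0.
  by move=> /ps_small; rewrite mul1r.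
have [inps prodE boxE] := box_event_full x psE.
set h := fun i => total_step ps i ord0 in inps prodE boxE.
have h_small i : 0 < h i < s i.
  have /andP[h0 hs] := ps_small _ (inps i); rewrite h0 /=.
  exact: lt_le_trans hs (s0_le i).
have /choice[b bP] : forall i, exists b, [/\ Phi b = G i (x i ord0 + h i),
     a i <= b < a i + Num.min r e & `|(b - a i) / h i - q i| < Num.min r e].
  by move=> i; case: (s_near i) => _; apply.
rewrite iter_diff_vector_cdf//; last 2 first.
- by rewrite psE enum_uniq.
- by move=> t /ps_small /andP[].
rewrite boxE prodE.
have ab i : a i <= b i by case: (bP i) => _ /andP[].
have h_gt0 i : 0 < h i by case/andP: (h_small i).
have prod_h_gt0 : 0 < \prod_i h i by apply: prodr_gt0 => i _; exact: h_gt0.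
have boxP := @gaussian_copula_box Sigma (fun i => x i ord0)
  (fun i => x i ord0 + h i) a b cop aG (fun i => let: And3 E _ _ := bP i in E).
have := @mvnormal_prob_box_bounds R d Sigma a b (Num.max (p - e) 0) (p + e).
rewrite -boxP; last by move=> i; rewrite lerDl ltW.
rewrite !lee_fin => /(_ _ _ ab) mM.
have {mM} /andP[mQ QM] : Num.max (p - e) 0 * \prod_i (b i - a i) <=
    fine (Q [set w | forall i, x i ord0 < U i w <= x i ord0 + h i]) <=
    (p + e) * \prod_i (b i - a i).
  apply: mM => [||z zab]; first by rewrite le_max lexx orbT.
    by rewrite addr_ge0// ltW.
  have : `|mvnormal_pdf Sigma z - p| < e.
    apply: pdf_near => i; rewrite tnth_mktuple.
    have /andP[az zb] := zab i; have [_ /andP[_ bri] _] := bP i.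
    rewrite gtr0_norm ?subr_gt0// ltrBlDl (le_lt_trans zb)//.
    by rewrite (lt_le_trans bri)// lerD2l ge_min lexx.
  rewrite ltr_distl => /andP[pz zp]; rewrite ge_max (ltW pz) (ltW zp) andbT /=.
  by rewrite /mvnormal_pdf mulr_ge0 ?expR_ge0// invr_ge0 sqrtr_ge0.
have qP i : `|(b i - a i) / h i - q i| < e.
  by have [_ _ /lt_le_trans] := bP i; apply; rewrite ge_min lexx orbT.
rewrite ler_pdivlMr// ler_pdivrMr// -!mulrA -!big_split /=.
apply/andP; split; [apply: le_trans mQ|apply: (le_trans QM)].
  rewrite ler_wpM2l ?le_max ?lexx ?orbT//; apply: ler_prod => i _.
  rewrite mulr_ge0 ?le_max ?lexx ?orbT ?(ltW (h_gt0 i))//=.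
  rewrite -ler_pdivlMr ?h_gt0// ge_max divr_ge0 ?subr_ge0 ?(ltW (h_gt0 i))// andbT.
  by have := qP i; rewrite ltr_distl => /andP[/ltW].
rewrite ler_wpM2l ?addr_ge0 ?(ltW e0)//; apply: ler_prod => i _.
rewrite subr_ge0 ab /= -ler_pdivrMr ?h_gt0//.
by have := qP i; rewrite ltr_distl => /andP[_ /ltW].
Qed.

Lemma gaussian_copula_density : mixed_partial F x = p * \prod_i q i.
Proof.
have q_ge0 i : 0 <= q i.
  rewrite /q divr_ge0 ?(ltW (phi_gt0 _))//.
  exact: (nondecreasing_derive1_ge0 (real_cdf_nondecreasing Q (mU i)) (@dG i)).
pose L e := Num.max (p - e) 0 * \prod_i Num.max (q i - e) 0.
pose M e := (p + e) * \prod_i (q i + e).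
have cmax (c : R) : continuous (fun e : R => Num.max (c - e) 0).
  move=> e; apply: (@continuous_max R R (fun e => c - e) (fun=> 0)).
    by apply: cvgB; [exact: cvg_cst|exact: cvg_id].
  exact: cst_continuous.
have cadd (c : R) : continuous (fun e : R => c + e).
  by move=> e; apply: cvgD; [exact: cvg_cst|exact: cvg_id].
have cL : continuous L.
  by apply: continuous_mul; [exact: cmax|apply: continuous_prod => i; exact: cmax].
have cM : continuous M.
  by apply: continuous_mul; [exact: cadd|apply: continuous_prod => i; exact: cadd].
(* Both families of bounds are continuous in e and agree at e = 0. *)
have -> : p * \prod_i q i = M 0.
  by rewrite /M addr0; congr (_ * _); apply: eq_bigr => i _; rewrite addr0.
apply/eqP; rewrite eq_le; apply/andP; split.
  rewrite -lerN2; apply: (@continuous_at0_le _ (fun e => - M e)).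
    by apply: continuousN; exact: cM.
  by move=> e e0; rewrite lerN2; case/andP: (mixed_partial_bounds e0).
have -> : M 0 = L 0.
  rewrite /M /L addr0 subr0 max_l//; congr (_ * _).
  by apply: eq_bigr => i _; rewrite addr0 subr0 max_l.
apply: continuous_at0_le; first exact: cL.
by move=> e e0; case/andP: (mixed_partial_bounds e0).
Qed.

End at_a_point.
End gaussian_copula_density.

Section degenerate_points.
Context {dT : measure_display} {T : measurableType dT} {R : realType}.
Context (Q : probability T R).

(** The bounds 0 and 1 are extreme values of a monotone function. *)
Lemma real_cdf_const_side (V : T -> R) (mV : measurable_fun [set: T] V) c :
  ~~ (0 < real_cdf Q V c < 1) ->
  exists side : bool, forall h, 0 < (-1) ^+ side * h ->
    real_cdf Q V (c + h) = real_cdf Q V c.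
Proof.
have Fle := real_cdf_nondecreasing Q mV.
have F0 := real_cdf_ge0 Q V; have F1 := real_cdf_le1 Q mV.
rewrite negb_and -!leNgt => /orP[Fc|Fc].
  exists true => h; rewrite mulN1r oppr_gt0 => h0.
  apply/eqP; rewrite eq_le Fle ?gerDl ?(ltW h0)//=; exact: le_trans Fc (F0 _).
exists false => h; rewrite mul1r => h0.
by apply/eqP; rewrite eq_le (le_trans (F1 _) Fc) Fle// lerDl ltW.
Qed.

(** The joint distribution function is dominated by the marginal one where this
    is 0, and where this is 1 the constraint on coordinate [i] holds almost
    surely. *)
Lemma vector_cdf_const_side d (U : 'I_d -> T -> R) i c :
  (forall j, measurable_fun [set: T] (U j)) ->
  ~~ (0 < real_cdf Q (U i) c < 1) ->
  exists side : bool, forall (y : 'cV[R]_d) h,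
    0 <= (-1) ^+ side * (y i ord0 - c) -> 0 <= (-1) ^+ side * h ->
    vector_cdf Q U (y + h *: unit_cv i) = vector_cdf Q U y.
Proof.
move=> mU; have mle (j : 'I_d) b := measurable_le_event (mU j) b.
have mF (y : 'cV[R]_d) : measurable [set w | forall j, U j w <= y j ord0].
  exact: measurable_forall (fun j => mle j (y j ord0)).
have unitE (y : 'cV[R]_d) h j : (y + h *: unit_cv i) j ord0 =
    if j == i then y i ord0 + h else y j ord0.
  by rewrite !mxE eqxx andbT; case: eqVneq => [->|_]; rewrite ?mulr1 ?mulr0 ?addr0.
rewrite negb_and -!leNgt => /orP[Fc|Fc].
  exists true => y h; rewrite !mulN1r !oppr_ge0 subr_le0 => yc h0.
  have F0 (z : 'cV[R]_d) : z i ord0 <= c -> vector_cdf Q U z = 0.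
    move=> zc; apply/eqP; rewrite eq_le fine_probability_ge0 andbT.
    apply: le_trans Fc; apply: fine_probability_le => // w /(_ i) Uz.
    exact: le_trans Uz zc.
  by rewrite !F0// unitE eqxx -[c]addr0 lerD.
exists false => y h; rewrite !mul1r subr_ge0 => yc h0.
apply/eqP; rewrite -subr_eq0 -fine_probabilityD//; last first.
  move=> w /= H j; rewrite unitE; case: eqVneq => [->|_]; last exact: H.
  by rewrite (le_trans (H i))// lerDl.
rewrite eq_le fine_probability_ge0 andbT.
have null : fine (Q ([set: T] `\` [set w | U i w <= c])) <= 0.
  by rewrite fine_probabilityD// probability_setT subr_le0.
apply: le_trans null; apply: fine_probability_le; [exact: measurableD..|].
move=> w [H1 H2]; split => //= Uc; apply: H2 => j.
have := H1 j; rewrite unitE; case: eqVneq => [-> _|//].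
exact: le_trans Uc yc.
Qed.

Lemma vector_cdf_mixed_partial_eq0 d (U : 'I_d -> T -> R) i (x : 'cV[R]_d) :
  (forall j, measurable_fun [set: T] (U j)) ->
  ~~ (0 < real_cdf Q (U i) (x i ord0) < 1) ->
  mixed_partial_ex (vector_cdf Q U) x ->
  mixed_partial (vector_cdf Q U) x = 0.
Proof.
move=> mU Gx exF; have [side Fc] := vector_cdf_const_side mU Gx.
have : 0 <= mixed_partial (vector_cdf Q U) x <= 0.
  apply: (@iter_partial_bounds _ _ _ _ _ (fun=> side) _ _ 1) => // ps psE ps1.
  rewrite (@iter_diff_eq0 _ _ _ _ (fun=> side) 1 i _ Fc) ?mul0r ?lexx ?subrr ?mulr0//.
  by rewrite psE mem_enum.
by rewrite -eq_le => /eqP.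
Qed.

Lemma real_cdf_derive1_eq0 (V : T -> R) (mV : measurable_fun [set: T] V) c :
  ~~ (0 < real_cdf Q V c < 1) -> derivable (real_cdf Q V) c 1 ->
  (real_cdf Q V)^`()%classic c = 0.
Proof.
by move=> Gc dG; have [side Fc] := real_cdf_const_side mV Gc; exact: derive1_eq0 Fc.
Qed.

End degenerate_points.

Section joint_density_cases.
Context {dT : measure_display} {T : measurableType dT} {R : realType}.

(** Of the degenerate points only this is needed: joint and marginal densities
    vanish together. *)
Lemma gaussian_copula_density_cases (Q : probability T R) d
    (U : 'I_d -> T -> R) (Sigma : 'M[R]_d) (x : 'cV[R]_d) :
  (forall i, measurable_fun [set: T] (U i)) ->
  (forall i, continuous (real_cdf Q (U i))) ->
  has_gaussian_copula Q U Sigma ->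
  (forall i, derivable (real_cdf Q (U i)) (x i ord0) 1) ->
  mixed_partial_ex (vector_cdf Q U) x ->
  let f := mixed_partial (vector_cdf Q U) x in
  let g i := (real_cdf Q (U i))^`()%classic (x i ord0) in
  (exists2 a : 'I_d -> R,
     forall i, Phi_inv (real_cdf Q (U i) (x i ord0)) = (a i)%:E &
     f = mvnormal_pdf Sigma [tuple a i | i < d] *
         \prod_i (g i / normal_pdf 0 1 (a i))) \/
  (f = 0 /\ exists i, g i = 0).
Proof.
move=> mU cU cop dG exF f g.
have [interior|/existsNP[i /negP Gi]] :=
    pselect (forall i, 0 < real_cdf Q (U i) (x i ord0) < 1); last first.
  right; split; first exact: (vector_cdf_mixed_partial_eq0 mU Gi).
  by exists i; exact: real_cdf_derive1_eq0.
left; have [a aG] := choice (fun i => Phi_onto (interior i)).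
exists a => [i|]; first by rewrite -aG PhiK.
exact: gaussian_copula_density.
Qed.

End joint_density_cases.

(** * Conditioning on the class label *)

Section conditioning.
Context {dT : measure_display} {T : measurableType dT} {R : realType}.
Context (P : probability T R) (E : set T) (mE : measurable E).

Definition conditional_probability : probability T R := mnormalize (mrestr P mE) P.

(** [A] is arbitrary because the events in the copula property, preimages under
    extended real scores, are not known to be measurable at this stage. *)
Lemma conditional_probabilityE A : (0 < P E)%E ->
  fine (conditional_probability A) = fine (P (A `&` E)) / fine (P E).
Proof.
move=> PE0; have PEfin : P E \is a fin_num by exact: fin_num_measure.
have ev : mrestr P mE [set: T] = P E by rewrite /mrestr setTI.
rewrite /conditional_probability /= /mnormalize /= ev gt_eqF//= lt_eqF ?ltey_eq ?PEfin//=.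
have r0 : 0 < (fine (P E))^-1 by rewrite invr_gt0 fine_gt0// PE0 ltey_eq PEfin.
rewrite /mrestr; case: (P (A `&` E)) => [r| |]; first by [].
  by rewrite mulyr gtr0_sg// mul1e mul0r.
by rewrite mulNyr gtr0_sg// mul1e mul0r.
Qed.

End conditioning.

(** * The identity *)

Section quadratic_forms.
Context {R : realType} {d : nat}.
Implicit Types (M : 'M[R]_d) (u v : 'cV[R]_d).

(** The cross terms are transposes of each other, hence cancel. *)
Lemma quadratic_form_difference M u v : M^T = M ->
  ((u + v)^T *m M *m (u - v)) ord0 ord0 =
  (u^T *m M *m u) ord0 ord0 - (v^T *m M *m v) ord0 ord0.
Proof.
move=> MT; have cross : (v^T *m M *m u) ord0 ord0 = (u^T *m M *m v) ord0 ord0.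
  rewrite -[in RHS](trmxK (u^T *m M *m v)) [in RHS]mxE.
  by rewrite !trmx_mul trmxK MT mulmxA.
rewrite [(u + v)^T]linearD /= !mulmxDl !mulmxDr !mulmxN !mxE.
by move: cross; rewrite !mxE => ->; ring.
Qed.

End quadratic_forms.

Section logarithms.
Context {R : realType}.

Lemma ln_prod (I : finType) (F : I -> R) : (forall i, 0 < F i) ->
  ln (\prod_i F i) = \sum_i ln (F i).
Proof.
move=> F0; suff [] : 0 < \prod_i F i /\ ln (\prod_i F i) = \sum_i ln (F i) by [].
apply: (big_ind2 (fun p s => 0 < p /\ ln p = s)).
- by rewrite ltr01 ln1.
- by move=> p s q t [p0 <-] [q0 <-]; rewrite mulr_gt0// lnM// posrE.
- by move=> i _; rewrite F0.
Qed.

Lemma lne_ratio_left0 (t : R) : lne (0%:E / t%:E) = -oo%E.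
Proof. by rewrite mul0e le0_lneNy. Qed.

Lemma lne_ratio_right0 (t : R) : 0 < t -> lne (t%:E / 0%:E) = +oo%E.
Proof. by move=> t0; rewrite inve0 gt0_muley ?lte_fin. Qed.

Lemma lne_ratio (s t : R) : 0 < s -> 0 < t ->
  lne (s%:E / t%:E) = (ln s - ln t)%:E.
Proof.
move=> s0 t0; rewrite lne_div ?in_itv /= ?leey ?lte_fin ?s0 ?t0//.
by rewrite !leNgt s0 t0 /=.
Qed.

End logarithms.

Section log_density.
Context {R : realType} {d : nat} (Sigma : 'M[R]_d).

Let K : R := (Num.sqrt ((2 * pi) ^+ d * \det Sigma))^-1.
Let quad (a : 'I_d -> R) : R :=
  ((\col_i a i)^T *m invmx Sigma *m (\col_i a i)) ord0 ord0.

Let mvnormal_pdfE (a : 'I_d -> R) :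
  mvnormal_pdf Sigma [tuple a i | i < d] = K * expR (- quad a / 2).
Proof.
have colE : \col_(i < d) tnth [tuple a i | i < d] i = \col_i a i.
  by apply/colP => i; rewrite !mxE tnth_mktuple.
by rewrite /mvnormal_pdf colE.
Qed.

(** The exponential never vanishes, so a nonzero value shows that the
    normalizing constant is positive.  The positivity of the density at the
    scores is obtained in this way from a joint density that is nonzero. *)
Lemma mvnormal_pdf_gt0 (a b : d.-tuple R) :
  mvnormal_pdf Sigma a != 0 -> 0 < mvnormal_pdf Sigma b.
Proof.
rewrite /mvnormal_pdf mulf_eq0 negb_or => /andP[K0 _].
by rewrite mulr_gt0 ?expR_gt0// lt_def K0 invr_ge0 sqrtr_ge0.
Qed.

Lemma gaussian_copula_log_ratio (a b g h : 'I_d -> R) :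
  Sigma^T = Sigma -> mvnormal_pdf Sigma [tuple a i | i < d] != 0 ->
  (forall i, 0 < g i) -> (forall i, 0 < h i) ->
  ln (mvnormal_pdf Sigma [tuple a i | i < d] *
        \prod_i (g i / normal_pdf 0 1 (a i))) -
  ln (mvnormal_pdf Sigma [tuple b i | i < d] *
        \prod_i (h i / normal_pdf 0 1 (b i))) =
  - 2^-1 * (\sum_i (a i + b i) *
              \sum_j (invmx Sigma - 1%:M) i j * (a j - b j)) +
  \sum_i (ln (g i) - ln (h i)).
Proof.
move=> SigmaT pdf0 g0 h0.
have K0 : 0 < K.
  move: pdf0; rewrite mvnormal_pdfE mulf_eq0 negb_or => /andP[K0 _].
  by rewrite lt_def K0 invr_ge0 sqrtr_ge0.
have lnE (c k : 'I_d -> R) : (forall i, 0 < k i) ->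
    ln (mvnormal_pdf Sigma [tuple c i | i < d] *
        \prod_i (k i / normal_pdf 0 1 (c i))) =
    ln K - quad c / 2 +
    \sum_i (ln (k i) - (ln (normal_peak 1) - c i ^+ 2 / 2)).
  move=> k0; have kphi i : 0 < k i / normal_pdf 0 1 (c i).
    by rewrite divr_gt0 ?phi_gt0.
  rewrite mvnormal_pdfE !lnM ?posrE ?mulr_gt0 ?expR_gt0 ?prodr_gt0//.
  rewrite expRK ln_prod// mulNr; congr (_ + _); apply: eq_bigr => i _.
  rewrite ln_div ?posrE ?phi_gt0// phiE lnM ?posrE ?expR_gt0 ?normal_peak_gt0 ?oner_eq0//.
  by rewrite expRK mulNr.
have quadE (c : 'I_d -> R) : quad c - \sum_i c i ^+ 2 =
    ((\col_i c i)^T *m (invmx Sigma - 1%:M) *m (\col_i c i)) ord0 ord0.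
  rewrite mulmxBr mulmxBl mulmx1.
  have -> (A B : 'M[R]_1) : (A - B) ord0 ord0 = A ord0 ord0 - B ord0 ord0.
    by rewrite !mxE.
  congr (_ - _); rewrite mxE.
  by apply: eq_bigr => i _; rewrite !mxE expr2.
have -> : \sum_i (a i + b i) * \sum_j (invmx Sigma - 1%:M) i j * (a j - b j) =
    (quad a - \sum_i a i ^+ 2) - (quad b - \sum_i b i ^+ 2).
  rewrite !quadE -quadratic_form_difference; last first.
    by rewrite linearB /= trmx1 trmx_inv SigmaT.
  rewrite -mulmxA mxE; apply: eq_bigr => i _; rewrite !mxE; congr (_ * _).
  by apply: eq_bigr => j _; rewrite !mxE.
rewrite !lnE// !sumrB -!mulr_suml.
by field.
Qed.

End log_density.

Section model_facts.
Context {dT : measure_display} {T : measurableType dT} {R : realType}.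
Context (P : probability T R) {d : nat}.
Context (X : {RV P >-> d.-tuple R}) (Y : {RV P >-> bool}).
Context (hY : forall y : bool, P (Y @^-1` [set y]) = (2^-1)%:E).
Context (hF : forall (y : bool) (i : 'I_d), continuous (marginal_cdf X Y y i)).

Let class_measurable y : measurable (class_event Y y).
Proof. by rewrite /class_event -[_ @^-1` _]setTI; exact: measurable_funPT. Qed.

Let Q y : probability T R := conditional_probability P (class_measurable y).

Let U (i : 'I_d) (w : T) : R := tnth (X w) i.

Let mU i : measurable_fun [set: T] (U i).
Proof. exact: (measurableT_comp (measurable_tnth i)). Qed.

Let cond_probE y A : cond_prob Y y A = fine (Q y A).
Proof. by rewrite conditional_probabilityE// hY lte_fin. Qed.

Let marginal_cdfE y i : marginal_cdf X Y y i = real_cdf (Q y) (U i).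
Proof. by apply/funext => t; rewrite /marginal_cdf cond_probE. Qed.

Let joint_cdfE y : joint_cdf X Y y = vector_cdf (Q y) U.
Proof. by apply/funext => t; rewrite /joint_cdf cond_probE. Qed.

Lemma joint_density_cases (Sigma : 'M[R]_d) (x : 'cV[R]_d) y :
  gaussian_copula X Y y Sigma ->
  (forall i, derivable (marginal_cdf X Y y i) (x i ord0) 1) ->
  mixed_partial_ex (joint_cdf X Y y) x ->
  (exists2 a : 'I_d -> R, forall i, alpha X Y y x i = (a i)%:E &
     joint_density X Y y x = mvnormal_pdf Sigma [tuple a i | i < d] *
       \prod_i (marginal_density X Y y i (x i ord0) / normal_pdf 0 1 (a i))) \/
  (joint_density X Y y x = 0 /\
   exists i, marginal_density X Y y i (x i ord0) = 0).
Proof.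
move=> cop dG exF.
have := @gaussian_copula_density_cases _ T R (Q y) d U Sigma x mU.
rewrite -joint_cdfE => /(_ _ _ _ exF) [].
- by move=> i; rewrite -marginal_cdfE; exact: hF.
- move=> B mB; rewrite -cop// cond_probE; congr (fine (Q y _))%:E.
  apply/seteqP; split=> w /= [z Bz zE]; exists z => // i; move: (zE i);
    by rewrite /alpha1 marginal_cdfE.
- by move=> i; rewrite -marginal_cdfE; exact: dG.
- move=> [a aE fE]; left; exists a => [i|].
    by rewrite /alpha /alpha1 marginal_cdfE.
  rewrite /joint_density fE; congr (_ * _); apply: eq_bigr => i _.
  by rewrite /marginal_density marginal_cdfE.
- move=> [f0 [i gi]]; right; split => //; exists i.
  by rewrite /marginal_density marginal_cdfE.
Qed.

Lemma marginal_density_ge0 y i t :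
  derivable (marginal_cdf X Y y i) t 1 -> 0 <= marginal_density X Y y i t.
Proof.
rewrite /marginal_density marginal_cdfE; apply: nondecreasing_derive1_ge0.
exact: real_cdf_nondecreasing.
Qed.

End model_facts.

Theorem theorem1p1 (dT : measure_display) (T : measurableType dT)
    (R : realType) (P : probability T R) (d : nat)
    (X : {RV P >-> d.-tuple R}) (Y : {RV P >-> bool})
    (Sigma Omega : 'M[R]_d)
    (hY : forall y : bool, P (Y @^-1` [set y]) = (2^-1)%:E)
    (hF : forall (y : bool) (i : 'I_d), continuous (marginal_cdf X Y y i))
    (hSigma : correlation_mx Sigma)
    (hSigma_unit : Sigma \in unitmx)
    (hcop : forall y : bool, gaussian_copula X Y y Sigma)
    (hOmega : Omega = invmx Sigma)
    (x : 'cV[R]_d)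
    (hx : identity_defined X Y Omega x) :
  (log_density_ratio X Y x =
     (- 2^-1)%:E *
       edot (fun i => alpha X Y false x i + alpha X Y true x i)
            (emulmx (Omega - 1%:M)
               (fun i => alpha X Y false x i - alpha X Y true x i)) +
     \sum_(i < d) lne ((marginal_density X Y false i (x i ord0))%:E /
                       (marginal_density X Y true i (x i ord0))%:E))%E /\
  ((- 2^-1)%:E *
       edot (fun i => alpha X Y false x i + alpha X Y true x i)
            (emulmx (Omega - 1%:M)
               (fun i => alpha X Y false x i - alpha X Y true x i)) +
     \sum_(i < d) lne ((marginal_density X Y false i (x i ord0))%:E /
                       (marginal_density X Y true i (x i ord0))%:E) =
   (- 2^-1)%:E *
       edot (fun i => alpha X Y false x i + alpha X Y true x i)
            (beta_star X Y Omega x) +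
     \sum_(i < d) Delta_log_f X Y i (x i ord0))%E.
Proof.
have [[exF dG f_neq0 g_neq0] _ [ratios_def total_def]] := hx.
set f := joint_density X Y; set g := fun y i => marginal_density X Y y i (x i ord0).
have g_ge0 y i : 0 <= g y i by exact: marginal_density_ge0 (dG y i).
have g_gt0 y i : g y i != 0 -> 0 < g y i by rewrite lt_def g_ge0 andbT.
have cases y := joint_density_cases hY hF (hcop y) (dG y) (exF y).
split; last first.
  congr (_ + _)%E; apply: eq_bigr => i _; rewrite /Delta_log_f -!/(g _ i).
  have [g0|/g_gt0 g0] := eqVneq (g false i) 0; last first.
    have [g1|/g_gt0 g1] := eqVneq (g true i) 0; last by rewrite lne_ratio// !lne_EFin.
    by rewrite g1 lne_ratio_right0// lne_EFin// le0_lneNy.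
  have [g1|/g_gt0 g1] := eqVneq (g true i) 0; first by case: (g_neq0 i).
  by rewrite g0 lne_ratio_left0 le0_lneNy// lne_EFin.
rewrite /log_density_ratio -!/(f _ x).
have pdf_of_density y a :
    f y x = mvnormal_pdf Sigma [tuple a i | i < d] *
       \prod_i (g y i / normal_pdf 0 1 (a i)) ->
    f y x != 0 -> mvnormal_pdf Sigma [tuple a i | i < d] != 0 /\
       forall i, 0 < g y i.
  move=> ->; rewrite mulf_eq0 negb_or => /andP[-> /prodf_neq0 gi]; split => // i.
  by apply: g_gt0; have := gi i isT; rewrite mulf_eq0 negb_or => /andP[].
(* The other class is used only to know that the normalizing constant of
   N(0, Sigma) is nonzero. *)
have density_eq0 y y' : f y x = 0 -> f y' x != 0 -> exists i, g y i = 0.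
  move=> fy fy'.
  case: (cases y) => [[a _ fE]|[_ []] i gi]; last by exists i.
  case: (cases y') => [[b _ fE']|[fE' _]]; last first.
    by move: fy'; rewrite /f fE' eqxx.
  have [pdfb _] := pdf_of_density _ _ fE' fy'.
  move: fy; rewrite /f fE => /eqP.
  rewrite mulf_eq0 gt_eqF ?(mvnormal_pdf_gt0 _ pdfb)//= => /prodf_eq0[i _].
  rewrite mulf_eq0 invr_eq0 (gt_eqF (phi_gt0 _)) orbF => /eqP gi.
  by exists i.
(* If f^0(x) = 0, both sides are -oo; if f^1(x) = 0, both are +oo, the hypothesis
   that the sums are defined excluding any term -oo. *)
have [f0|f0] := eqVneq (f false x) 0.
  have f1 : f true x != 0 by apply/eqP => f1; exact: f_neq0.
  have [i gi] := density_eq0 _ _ f0 f1.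
  rewrite f0 lne_ratio_left0.
  have -> : (\sum_(i < d) lne ((g false i)%:E / (g true i)%:E) = -oo)%E.
    apply/esum_eqNyP; exists i; split => //.
    by rewrite gi lne_ratio_left0.
  by rewrite addeNy.
case: (cases false) => [[a aE fa]|[fE _]]; last by move: f0; rewrite /f fE eqxx.
have [pdfa g0_gt0] := pdf_of_density _ _ fa f0.
have f0_gt0 : 0 < f false x.
  rewrite /f fa mulr_gt0 ?(mvnormal_pdf_gt0 _ pdfa)//.
  by apply: prodr_gt0 => i _; rewrite divr_gt0 ?phi_gt0 //; exact: g0_gt0.
have [f1|f1] := eqVneq (f true x) 0.
  have [i gi] := density_eq0 _ _ f1 f0.
  rewrite f1 lne_ratio_right0//.
  have ri : lne ((g false i)%:E / (g true i)%:E) = +oo%E.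
    by rewrite gi lne_ratio_right0.
  have sum_y : (\sum_(i < d) lne ((g false i)%:E / (g true i)%:E) = +oo)%E.
    apply/esum_eqyP => [j _|]; last first.
      by exists i.
    have := ratios_def i j; rewrite /log_marginal_ratio -!/(g _ _) ri.
    by rewrite adde_defC; case: (lne _).
  rewrite sum_y addey//.
  move: total_def; rewrite /log_marginal_ratio.
  under eq_bigr do rewrite -!/(g _ _).
  rewrite sum_y /edot /emulmx /sum_alpha /beta_star /Delta_alpha.
  by rewrite adde_defC; case: (_ * _)%E.
case: (cases true) => [[b bE fb]|[fE _]]; last by move: f1; rewrite /f fE eqxx.
have [pdfb g1_gt0] := pdf_of_density _ _ fb f1.
have f1_gt0 : 0 < f true x.
  rewrite /f fb mulr_gt0 ?(mvnormal_pdf_gt0 _ pdfb)//.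
  by apply: prodr_gt0 => i _; rewrite divr_gt0 ?phi_gt0 //; exact: g1_gt0.
have [SigmaT _ _] := hSigma.
rewrite lne_ratio// /f fa fb (gaussian_copula_log_ratio b SigmaT pdfa)//.
rewrite hOmega EFinD EFinM; congr (_ * _ + _)%E.
  rewrite /edot /emulmx -sumEFin; apply: eq_bigr => i _.
  rewrite aE bE EFinM -EFinD; congr (_ * _)%E.
  by rewrite -sumEFin; apply: eq_bigr => j _; rewrite aE bE EFinM.
by rewrite -sumEFin; apply: eq_bigr => i _; rewrite -!/(g _ i) lne_ratio.
Qed.
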